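(* Let $(\gamma,\nu_1,\nu_2):I\to\mathbb{R}^3_1\times\Delta_1$ be a spacelike framed curve with $\mu=\nu_1\times\nu_2$, $\delta=\langle\nu_1,\nu_1\rangle$ and curvature $(\alpha,l_1,l_2,l_3)$. Let $\Theta:I\to\mathbb{R}$ be a smooth function and put $$\breve\nu_1=\cosh\Theta\,\nu_1-\sinh\Theta\,\nu_2,\qquad \breve\nu_2=-\sinh\Theta\,\nu_1+\cosh\Theta\,\nu_2 .$$ Then $(\gamma,\breve\nu_1,\breve\nu_2):I\to\mathbb{R}^3_1\times\Delta_1$ is a spacelike framed curve and $\breve\nu_1\times\breve\nu_2=\mu$. Moreover: (1) (Bishop type) If $\Theta'(s)=l_1(s)$ for all $s\in I$, then $$\mu'=-\delta\breve l_2\,\breve\nu_1+\delta\breve l_3\,\breve\nu_2,\qquad \breve\nu_1'=\breve l_2\,\mu,\qquad \breve\nu_2'=\breve l_3\,\mu,$$ where $\breve l_2=l_2\cosh\Theta-l_3\sinh\Theta$ and $\breve l_3=-l_2\sinh\Theta+l_3\cosh\Theta$. (2) (Frenet-Serret type) If $l_2=p\cosh\Theta$ and $l_3=p\sinh\Theta$ for a function $p:I\to\mathbb{R}$ with $p(s)=\|\mu'(s)\|\neq 0$ for all $s\in I$, then, with $q=-\Theta'+l_1$, $$\mu'=-\delta p\,\breve\nu_1,\qquad \breve\nu_1'=p\,\mu+q\,\breve\nu_2,\qquad \breve\nu_2'=q\,\breve\nu_1 .$$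
   Context: $\mathbb{R}^3_1$ is $\mathbb{R}^3$ with the Lorentzian inner product $\langle\omega,\varsigma\rangle=-\omega_1\varsigma_1+\omega_2\varsigma_2+\omega_3\varsigma_3$, norm $\|\omega\|=\sqrt{|\langle\omega,\omega\rangle|}$, and vector product $\omega\times\varsigma=(-(\omega_2\varsigma_3-\omega_3\varsigma_2),\ \omega_3\varsigma_1-\omega_1\varsigma_3,\ \omega_1\varsigma_2-\omega_2\varsigma_1)$. Put $\mathbb{S}^2_1=\{\omega:\langle\omega,\omega\rangle=1\}$ and $\mathbb{H}^2_0=\{\omega:\langle\omega,\omega\rangle=-1\}$. $I$ is an open interval. $\Delta_1$ denotes the set of pairs $(\nu_1,\nu_2)$ with $\langle\nu_1,\nu_2\rangle=0$ lying in $\mathbb{S}^2_1\times\mathbb{H}^2_0$, or the analogous set in $\mathbb{H}^2_0\times\mathbb{S}^2_1$. A spacelike framed curve is a smooth map $(\gamma,\nu_1,\nu_2):I\to\mathbb{R}^3_1\times\Delta_1$ with $\langle\gamma',\nu_1\rangle=\langle\gamma',\nu_2\rangle=0$ on $I$. Put $\mu=\nu_1\times\nu_2$ (a unit spacelike field) and $\delta=\langle\nu_1,\nu_1\rangle\in\{1,-1\}$; the smooth function $\alpha$ is defined by $\gamma'=\alpha\mu$ ($\gamma$ is allowed to be singular where $\alpha=0$). The smooth functions $l_1,l_2,l_3$ are defined by the Frenet-type formulas $$\mu'=-\delta l_2\nu_1+\delta l_3\nu_2,\qquad \nu_1'=l_2\mu+l_1\nu_2,\qquad \nu_2'=l_3\mu+l_1\nu_1,$$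 and $(\alpha,l_1,l_2,l_3)$ is called the curvature of the spacelike framed curve. *)

(* Defs.v *)
From HB Require Import structures.
From mathcomp Require Import all_boot all_order all_algebra.
From mathcomp Require Import all_classical all_reals all_analysis.
Set Implicit Arguments.
Unset Strict Implicit.
Unset Printing Implicit Defensive.
Import Order.TTheory GRing.Theory Num.Theory.
Import numFieldNormedType.Exports.
Local Open Scope ring_scope.
Local Open Scope classical_set_scope.

Section LorentzMinkowski.
Variable R : realType.
Implicit Types (I : set R) (w v : 'rV[R]_3).

Definition cosh (x : R) : R := (expR x + expR (- x)) / 2.
Definition sinh (x : R) : R := (expR x - expR (- x)) / 2.

(* Functions on an open set I are represented by total functions on R, whose
   values outside I are irrelevant; I is meant to be open, so that the iterated
   derivatives at a point of I only depend on the restriction to I. *)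
Definition smooth_on (V : normedModType R) I (f : R -> V) : Prop :=
  forall (n : nat) (s : R), I s -> derivable (f^`(n)) s 1.

(* The coordinates w_1, w_2, w_3 are w 0 0, w 0 1, w 0 2; only the inner
   product below is Lorentzian, the topology used for derivatives is the usual
   one on row vectors. *)
Definition vec3 (a b c : R) : 'rV[R]_3 := \row_(i < 3) [:: a; b; c]`_i.

Definition linner w v : R :=
  - (w 0 0 * v 0 0) + w 0 1 * v 0 1 + w 0 2 * v 0 2.

Definition lnorm w : R := Num.sqrt `|linner w w|.

Definition lcross w v : 'rV[R]_3 :=
  vec3 (- (w 0 1 * v 0 2 - w 0 2 * v 0 1))
       (w 0 2 * v 0 0 - w 0 0 * v 0 2)
       (w 0 0 * v 0 1 - w 0 1 * v 0 0).

Definition S21 : set 'rV[R]_3 := [set w | linner w w = 1].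
Definition H20 : set 'rV[R]_3 := [set w | linner w w = -1].

(* The two possible meanings of Delta_1, according to the causal character of
   the first vector. *)
Definition Delta1_SH : set ('rV[R]_3 * 'rV[R]_3) :=
  [set u | [/\ u.1 \in S21, u.2 \in H20 & linner u.1 u.2 = 0]].
Definition Delta1_HS : set ('rV[R]_3 * 'rV[R]_3) :=
  [set u | [/\ u.1 \in H20, u.2 \in S21 & linner u.1 u.2 = 0]].
Definition is_Delta1 (D : set ('rV[R]_3 * 'rV[R]_3)) : Prop :=
  D = Delta1_SH \/ D = Delta1_HS.

Definition spacelike_framed_curve I (D : set ('rV[R]_3 * 'rV[R]_3))
    (gamma nu1 nu2 : R -> 'rV[R]_3) : Prop :=
  [/\ smooth_on I gamma, smooth_on I nu1, smooth_on I nu2 &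
   forall s, I s ->
     [/\ D (nu1 s, nu2 s),
         linner (derive1 gamma s) (nu1 s) = 0 &
         linner (derive1 gamma s) (nu2 s) = 0]].

Definition frame_mu (nu1 nu2 : R -> 'rV[R]_3) (s : R) : 'rV[R]_3 :=
  lcross (nu1 s) (nu2 s).

Definition frame_delta (nu1 : R -> 'rV[R]_3) (s : R) : R :=
  linner (nu1 s) (nu1 s).

(* The formulas determine alpha, l1, l2, l3 uniquely on I, since
   (mu, nu1, nu2) is pointwise a basis along a framed curve. *)
Definition is_curvature I (gamma nu1 nu2 : R -> 'rV[R]_3)
    (alpha l1 l2 l3 : R -> R) : Prop :=
  let mu := frame_mu nu1 nu2 in
  let delta := frame_delta nu1 in
  [/\ smooth_on I alpha, smooth_on I l1, smooth_on I l2, smooth_on I l3 &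
   forall s, I s ->
     [/\ derive1 gamma s = alpha s *: mu s,
         derive1 mu s = (- delta s * l2 s) *: nu1 s + (delta s * l3 s) *: nu2 s,
         derive1 nu1 s = l2 s *: mu s + l1 s *: nu2 s &
         derive1 nu2 s = l3 s *: mu s + l1 s *: nu1 s]].

End LorentzMinkowski.

(* Main.v *)
Require Import Defs.
From mathcomp Require Import all_boot all_order all_algebra.
From mathcomp Require Import all_classical all_reals all_analysis.
From mathcomp Require Import ring.
Import Order.TTheory GRing.Theory Num.Theory.
Import numFieldNormedType.Exports.
Set Implicit Arguments.
Unset Strict Implicit.
Local Open Scope ring_scope.
Local Open Scope classical_set_scope.

(** The pair (nu1, nu2) is replaced by its image under the hyperbolic rotation
    of angle Theta. As this rotation has determinant cosh^2 - sinh^2 = 1 and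
    preserves the Lorentzian form of the plane spanned by nu1 and nu2, the
    rotated pair stays in the same component of Delta_1, remains orthogonal to
    gamma', and has the same vector product mu. Differentiating, the rotation
    contributes - Theta' to the rate at which nu1 and nu2 turn into each other,
      bnu1' = (l2 cosh - l3 sinh) mu + (l1 - Theta') bnu2,
      bnu2' = (- l2 sinh + l3 cosh) mu + (l1 - Theta') bnu1
    ([is_derive_rotate]), and both special frames can be read off from this: the
    Bishop frame kills l1 - Theta', and the Frenet-Serret frame is the one for
    which the second curvature - l2 sinh + l3 cosh vanishes. The formulas for
    mu' only express nu1 and nu2 in terms of the rotated pair.

    The analytic content is the smoothness of the rotated fields. Smoothness is
    a statement about all iterated derivatives, and is obtained by induction
    on the order of differentiability: by [ndiff_on_of_derivative] it suffices to
    know that the derivative on I is of the preceding order, and the derivatives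
    of sums, products and hyperbolic functions are expressions of the same
    shape. *)

(** * Differentiability of finite order on an open set *)

Section FiniteOrder.
Context {R : realType}.

(** Truncation of smoothness, on which induction over the order is possible: the
    n-th derivative exists, continuous or not. *)
Definition ndiff_on {V : normedModType R} (n : nat) (I : set R) (f : R -> V) :=
  forall k s, (k < n)%N -> I s -> derivable (f^`(k)) s 1.

Lemma smooth_onP {V : normedModType R} (I : set R) (f : R -> V) :
  smooth_on I f <-> forall n, ndiff_on n I f.
Proof. by split=> [fI n k s _|fI n s]; [exact: fI|exact: (fI n.+1)]. Qed.

Lemma ndiff_onS {V : normedModType R} n (I : set R) (f : R -> V) :
  ndiff_on n.+1 I f <->
  (forall s, I s -> derivable f s 1) /\ ndiff_on n I (derive1 f).
Proof.
split=> [fI|[f1 fI] [|k] s kn Is]; last 2 first.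
- exact: f1.
- by rewrite derive1Sn; exact: fI.
split=> [s|k s kn Is]; first exact: (fI 0%N).
by rewrite -derive1Sn; exact: fI.
Qed.

Lemma ndiff_onW {V : normedModType R} n (I : set R) (f : R -> V) :
  ndiff_on n.+1 I f -> ndiff_on n I f.
Proof. by move=> fI k s kn; apply: fI; exact: ltnW. Qed.

Lemma near_open {T : Type} (I : set R) (f g : R -> T) (s : R) :
  open I -> (forall t, I t -> f t = g t) -> I s -> {near s, f =1 g}.
Proof. by move=> oI fg Is; near=> t; apply: fg; near: t; exact: open_nbhs_nbhs.
Unshelve. all: by end_near. Qed.

Lemma eq_ndiff_on {V : normedModType R} n (I : set R) (f g : R -> V) :
  open I -> (forall s, I s -> f s = g s) -> ndiff_on n I f -> ndiff_on n I g.
Proof.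
move=> oI; elim: n f g => [//|n IHn] f g fg /ndiff_onS[f1 f'I].
apply/ndiff_onS; split=> [s Is|].
  exact: near_eq_derivable (near_open oI fg Is) (f1 s Is).
apply: (IHn _ _ _ f'I) => s Is.
by rewrite !derive1E; apply/near_eq_derive/(near_open oI fg Is).
Qed.

(** The derivative need only be known on I, because I is open. *)
Lemma ndiff_on_of_derivative {V : normedModType R} n (I : set R) (f df : R -> V) :
  open I -> (forall s, I s -> is_derive s 1 f (df s)) ->
  ndiff_on n I df -> ndiff_on n.+1 I f.
Proof.
move=> oI fdf dfI; apply/ndiff_onS; split=> [s /fdf[]//|].
by apply: (eq_ndiff_on (f := df)) => // s /fdf[_ <-]; rewrite derive1E.
Qed.

Lemma is_derive_ndiff_on {V : normedModType R} n (I : set R) (f : R -> V) s :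
  ndiff_on n.+1 I f -> I s -> is_derive s 1 f (derive1 f s).
Proof. by move=> /ndiff_onS[f1 _] /f1 fs; rewrite derive1E; exact: derivableP. Qed.

Lemma ndiff_onD {V : normedModType R} n (I : set R) (f g : R -> V) :
  open I -> ndiff_on n I f -> ndiff_on n I g -> ndiff_on n I (f + g).
Proof.
move=> oI; elim: n f g => [//|n IHn] f g fI gI.
apply: (ndiff_on_of_derivative (f := f + g) (df := derive1 f + derive1 g) oI _ _)
  => [s Is|].
  exact: is_deriveD (is_derive_ndiff_on fI Is) (is_derive_ndiff_on gI Is).
have [[_ f'I] [_ g'I]] := ((ndiff_onS _ _ _).1 fI, (ndiff_onS _ _ _).1 gI).
exact: IHn f'I g'I.
Qed.

Lemma ndiff_onN {V : normedModType R} n (I : set R) (f : R -> V) :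
  open I -> ndiff_on n I f -> ndiff_on n I (- f).
Proof.
move=> oI; elim: n f => [//|n IHn] f fI.
apply: (ndiff_on_of_derivative (f := - f) (df := - derive1 f) oI _ _) => [s Is|].
  exact: is_deriveN (is_derive_ndiff_on fI Is).
by apply: IHn; case/ndiff_onS: fI.
Qed.

(** As for the product of two scalar functions: the increment splits as
    (increment of f) g s + f (increment of g), and f is continuous at s. *)
Lemma is_derive_scale {V : normedModType R} (f : R -> R) (g : R -> V)
    (s df : R) (dg : V) :
  is_derive s 1 f df -> is_derive s 1 g dg ->
  is_derive s 1 (fun t => f t *: g t) (df *: g s + f s *: dg).
Proof.
move=> [f1 <-] [g1 <-].
have quot : (fun h : R => h^-1 *:
    (((fun t => f t *: g t) \o shift s) (h *: 1) - f s *: g s)) @ 0^'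
    --> 'D_1 f s *: g s + f s *: 'D_1 g s.
  pose qf h := h^-1 *: (f (h *: 1 + s) - f s).
  pose qg h := h^-1 *: (g (h *: 1 + s) - g s).
  rewrite (_ : (fun h : R => _) =
      fun h => qf h *: g s + f (h *: 1 + s) *: qg h); last first.
    rewrite funeqE => h /=; rewrite /qf /qg.
    rewrite scalerA [f _ * _]mulrC -[(_ * f _) *: _]scalerA -scalerA -scalerDr.
    by congr (_ *: _); rewrite scalerBl scalerBr [RHS]addrC subrKA.
  apply: cvgD; first by apply: cvgZr_tmp; exact: f1.
  apply: cvgZ; last exact: g1.
  suff : {for 0, continuous (fun h : R => f (h *: 1 + s))}.
    by move=> /continuous_withinNx; rewrite scale0r add0r.
  exact/differentiable_continuous/derivable1_diffP/(derivable1P _ _ _).1.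
apply: DeriveDef; last exact: cvg_lim quot.
by apply/cvg_ex; eexists; exact: quot.
Qed.

Lemma ndiff_on_scale {V : normedModType R} n (I : set R) (f : R -> R) (g : R -> V) :
  open I -> ndiff_on n I f -> ndiff_on n I g -> ndiff_on n I (fun s => f s *: g s).
Proof.
move=> oI; elim: n f g => [//|n IHn] f g fI gI.
apply: (ndiff_on_of_derivative
  (df := (fun s => derive1 f s *: g s) + (fun s => f s *: derive1 g s)) oI _ _)
  => [s Is|].
  exact: is_derive_scale (is_derive_ndiff_on fI Is) (is_derive_ndiff_on gI Is).
have [[_ f'I] [_ g'I]] := ((ndiff_onS _ _ _).1 fI, (ndiff_onS _ _ _).1 gI).
exact: ndiff_onD oI (IHn _ _ f'I (ndiff_onW gI)) (IHn _ _ (ndiff_onW fI) g'I).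
Qed.

End FiniteOrder.

(** * Hyperbolic functions *)

Section Hyperbolic.
Context {R : realType}.

Lemma cosh2_sinh2 (x : R) : cosh x * cosh x - sinh x * sinh x = 1.
Proof.
have := expRxMexpNx_1 x; rewrite /cosh /sinh; set a := expR x; set b := expR _.
by move=> ab1; transitivity (a * b); first by field.
Qed.

Lemma is_derive_exp_opp (x : R) :
  is_derive x 1 (fun t => expR (- t)) (- expR (- x)).
Proof.
have -> : - expR (- x) = expR (- x) * - 1 by rewrite mulrN1.
exact: (@is_derive1_comp _ expR -%R).
Qed.

Lemma is_derive_cosh (x : R) : is_derive x 1 (@cosh R) (sinh x).
Proof.
have dN := is_derive_exp_opp x.
have -> : @cosh R = 2^-1 \*: (expR + fun t : R => expR (- t)).
  by apply/funext => t; rewrite /cosh mulrC.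
have -> : sinh x = 2^-1 *: (expR x + - expR (- x)).
  by rewrite /sinh mulrC.
exact: is_deriveZ.
Qed.

Lemma is_derive_sinh (x : R) : is_derive x 1 (@sinh R) (cosh x).
Proof.
have dN := is_derive_exp_opp x.
have -> : @sinh R = 2^-1 \*: (expR - fun t : R => expR (- t)).
  by apply/funext => t; rewrite /sinh mulrC.
have -> : cosh x = 2^-1 *: (expR x - - expR (- x)).
  by rewrite opprK /cosh mulrC.
exact: is_deriveZ.
Qed.

Lemma is_derive_cosh_comp (f : R -> R) (s df : R) :
  is_derive s 1 f df -> is_derive s 1 (@cosh R \o f) (df * sinh (f s)).
Proof.
by move=> fs; rewrite mulrC; apply: is_derive1_comp => //; exact: is_derive_cosh.
Qed.

Lemma is_derive_sinh_comp (f : R -> R) (s df : R) :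
  is_derive s 1 f df -> is_derive s 1 (@sinh R \o f) (df * cosh (f s)).
Proof.
by move=> fs; rewrite mulrC; apply: is_derive1_comp => //; exact: is_derive_sinh.
Qed.

(** Each of the two is needed, one order lower, to differentiate the other. *)
Lemma ndiff_on_cosh_sinh n (I : set R) (f : R -> R) :
  open I -> ndiff_on n I f -> ndiff_on n I (@cosh R \o f) /\ ndiff_on n I (@sinh R \o f).
Proof.
move=> oI; elim: n => [_|n IHn fI]; first by split=> k s; rewrite ltn0.
have [chI shI] := IHn (ndiff_onW fI).
have /ndiff_onS[_ f'I] := fI.
split.
- apply: (ndiff_on_of_derivative (df := fun s => derive1 f s *: sinh (f s)) oI _ _)
    => [s Is|].
    exact: is_derive_cosh_comp (is_derive_ndiff_on fI Is).
  exact: ndiff_on_scale oI f'I shI.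
- apply: (ndiff_on_of_derivative (df := fun s => derive1 f s *: cosh (f s)) oI _ _)
    => [s Is|].
    exact: is_derive_sinh_comp (is_derive_ndiff_on fI Is).
  exact: ndiff_on_scale oI f'I chI.
Qed.

End Hyperbolic.

(** * Hyperbolic rotation of a frame *)

Section Rotation.
Context {R : realType}.
Implicit Types (u v w : 'rV[R]_3) (c s : R).

Lemma linnerC u v : linner u v = linner v u.
Proof. by rewrite /linner ![u _ _ * _]mulrC. Qed.

Lemma linner_comb_r w u v c s :
  linner w (c *: u + s *: v) = c * linner w u + s * linner w v.
Proof. by rewrite /linner !mxE; ring. Qed.

Lemma linner_rotate1 u v c s : linner u v = 0 ->
  linner (c *: u - s *: v) (c *: u - s *: v) =
  c * c * linner u u + s * s * linner v v.
Proof.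
move=> uv0; rewrite -scaleNr linner_comb_r ![linner (_ + _) _]linnerC.
by rewrite !linner_comb_r [linner v u]linnerC uv0; ring.
Qed.

Lemma linner_rotate2 u v c s : linner u v = 0 ->
  linner (- s *: u + c *: v) (- s *: u + c *: v) =
  s * s * linner u u + c * c * linner v v.
Proof.
move=> uv0; rewrite linner_comb_r ![linner (_ + _) _]linnerC.
by rewrite !linner_comb_r [linner v u]linnerC uv0; ring.
Qed.

Lemma linner_rotate12 u v c s : linner u v = 0 ->
  linner (c *: u - s *: v) (- s *: u + c *: v) =
  - (c * s) * (linner u u + linner v v).
Proof.
move=> uv0; rewrite -scaleNr linner_comb_r ![linner (_ + _) _]linnerC.
by rewrite !linner_comb_r [linner v u]linnerC uv0; ring.
Qed.

Lemma lcross_rotate u v c s : c * c - s * s = 1 ->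
  lcross (c *: u - s *: v) (- s *: u + c *: v) = lcross u v.
Proof.
move=> cs; rewrite -[RHS]scale1r -cs; apply/rowP => i; rewrite !mxE.
by case: i => [[|[|[|//]]] ?] /=; ring.
Qed.

(** Here u and v have opposite unit squares, so that the cross terms cancel and
    c^2 - s^2 factors out of the squares of the rotated vectors. *)
Lemma Delta1_rotate (D : set ('rV[R]_3 * 'rV[R]_3)) u v c s :
  is_Delta1 D -> c * c - s * s = 1 -> D (u, v) ->
  D (c *: u - s *: v, - s *: u + c *: v).
Proof.
move=> hD cs; case: hD => ->; rewrite /Delta1_SH /Delta1_HS /S21 /H20 /=.
- case; rewrite !inE /= => uu vv uv; split; rewrite ?inE /=.
  + by rewrite linner_rotate1 // uu vv mulr1 mulrN1 cs.
  + by rewrite linner_rotate2 // uu vv mulr1 mulrN1 -opprB cs.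
  + by rewrite linner_rotate12 // uu vv ?subrr ?addNr mulr0.
- case; rewrite !inE /= => uu vv uv; split; rewrite ?inE /=.
  + by rewrite linner_rotate1 // uu vv mulr1 mulrN1 addrC -opprB cs.
  + by rewrite linner_rotate2 // uu vv mulr1 mulrN1 addrC cs.
  + by rewrite linner_rotate12 // uu vv ?subrr ?addNr mulr0.
Qed.

(** The combination a u - b v is the shape of mu' up to the factor - delta; it
    pairs (a, b) with (u, v) by the form that hyperbolic rotations preserve, so
    rotating the coefficients along with the vectors does not change it. *)
Lemma comb_rotate u v c s (a b : R) : c * c - s * s = 1 ->
  (a * c - b * s) *: (c *: u - s *: v) - (- a * s + b * c) *: (- s *: u + c *: v)
  = a *: u - b *: v.
Proof.
move=> cs; rewrite -[RHS]scale1r -cs; apply/rowP => i; rewrite !mxE.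
by ring.
Qed.

(** For constant nu1 and nu2 the derivatives would be - Theta' bnu2 and
    - Theta' bnu1; the terms in l1 rotate to the same exchange of bnu1 and bnu2,
    now with coefficient l1, so the two contributions add up. *)
Lemma is_derive_rotate (nu1 nu2 : R -> 'rV[R]_3) (Theta : R -> R) (t dTheta : R)
    (mu : 'rV[R]_3) (l1 l2 l3 : R) :
  let bnu1 := fun s => cosh (Theta s) *: nu1 s - sinh (Theta s) *: nu2 s in
  let bnu2 := fun s => - sinh (Theta s) *: nu1 s + cosh (Theta s) *: nu2 s in
  is_derive t 1 Theta dTheta ->
  is_derive t 1 nu1 (l2 *: mu + l1 *: nu2 t) ->
  is_derive t 1 nu2 (l3 *: mu + l1 *: nu1 t) ->
  is_derive t 1 bnu1 ((l2 * cosh (Theta t) - l3 * sinh (Theta t)) *: mu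
                      + (- dTheta + l1) *: bnu2 t) /\
  is_derive t 1 bnu2 ((- l2 * sinh (Theta t) + l3 * cosh (Theta t)) *: mu
                      + (- dTheta + l1) *: bnu1 t).
Proof.
move=> bnu1 bnu2 dT d1 d2.
have dc := is_derive_cosh_comp dT.
have ds := is_derive_sinh_comp dT.
have dsN : is_derive t 1 (fun r => - sinh (Theta r)) (- (dTheta * cosh (Theta t))).
  exact: is_deriveN ds.
split.
- apply: (@is_derive_eq _ _ _ bnu1).
    exact: is_deriveB (is_derive_scale dc d1)
                      (is_derive_scale ds d2).
  by rewrite /bnu2 /=; apply/rowP => i; rewrite !mxE; ring.
- apply: (@is_derive_eq _ _ _ bnu2).
    exact: is_deriveD (is_derive_scale dsN d1)
                      (is_derive_scale dc d2).
  by rewrite /bnu1 /=; apply/rowP => i; rewrite !mxE; ring.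
Qed.

End Rotation.

Unset Implicit Arguments.

Theorem mainTheorem1 (R : realType) (I : set R)
    (D : set ('rV[R]_3 * 'rV[R]_3))
    (gamma nu1 nu2 : R -> 'rV[R]_3) (alpha l1 l2 l3 Theta : R -> R)
    (openI : open I) (itvI : is_interval I) (hD : is_Delta1 D)
    (framed : spacelike_framed_curve I D gamma nu1 nu2)
    (curv : is_curvature I gamma nu1 nu2 alpha l1 l2 l3)
    (smoothTheta : smooth_on I Theta) :
  let mu := frame_mu nu1 nu2 in
  let delta := frame_delta nu1 in
  let bnu1 := fun s => cosh (Theta s) *: nu1 s - sinh (Theta s) *: nu2 s in
  let bnu2 := fun s => - sinh (Theta s) *: nu1 s + cosh (Theta s) *: nu2 s in
  [/\ spacelike_framed_curve I D gamma bnu1 bnu2,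
      forall s, I s -> lcross (bnu1 s) (bnu2 s) = mu s,
      (forall s, I s -> derive1 Theta s = l1 s) ->
      let bl2 := fun s => l2 s * cosh (Theta s) - l3 s * sinh (Theta s) in
      let bl3 := fun s => - l2 s * sinh (Theta s) + l3 s * cosh (Theta s) in
      forall s, I s ->
        [/\ derive1 mu s =
              (- delta s * bl2 s) *: bnu1 s + (delta s * bl3 s) *: bnu2 s,
            derive1 bnu1 s = bl2 s *: mu s &
            derive1 bnu2 s = bl3 s *: mu s] &
      forall p : R -> R,
        (forall s, I s -> l2 s = p s * cosh (Theta s)) ->
        (forall s, I s -> l3 s = p s * sinh (Theta s)) ->
        (forall s, I s -> p s = lnorm (derive1 mu s) /\ lnorm (derive1 mu s) <> 0) ->
        let q := fun s => - derive1 Theta s + l1 s in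
        forall s, I s ->
          [/\ derive1 mu s = (- delta s * p s) *: bnu1 s,
              derive1 bnu1 s = p s *: mu s + q s *: bnu2 s &
              derive1 bnu2 s = q s *: bnu1 s]].
Proof.
move=> mu delta bnu1 bnu2.
have [smg /smooth_onP sm1 /smooth_onP sm2 frame] := framed.
have [_ _ _ _ frenet] := curv.
have ThetaI : forall n, ndiff_on n I Theta by apply/smooth_onP.
have cs s : cosh (Theta s) * cosh (Theta s) - sinh (Theta s) * sinh (Theta s) = 1.
  exact: cosh2_sinh2.
have chI n : ndiff_on n I (@cosh R \o Theta) by exact: (ndiff_on_cosh_sinh openI (ThetaI n)).1.
have shI n : ndiff_on n I (@sinh R \o Theta) by exact: (ndiff_on_cosh_sinh openI (ThetaI n)).2.
have derivative s : I s ->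
    is_derive s 1 bnu1 ((l2 s * cosh (Theta s) - l3 s * sinh (Theta s)) *: mu s
                        + (- derive1 Theta s + l1 s) *: bnu2 s) /\
    is_derive s 1 bnu2 ((- l2 s * sinh (Theta s) + l3 s * cosh (Theta s)) *: mu s
                        + (- derive1 Theta s + l1 s) *: bnu1 s).
  move=> Is; have [_ _ e1 e2] := frenet s Is.
  have d1 := is_derive_ndiff_on (sm1 1%N) Is; rewrite e1 in d1.
  have d2 := is_derive_ndiff_on (sm2 1%N) Is; rewrite e2 in d2.
  exact: is_derive_rotate (is_derive_ndiff_on (ThetaI 1%N) Is) d1 d2.
have dmu s : I s -> derive1 mu s = - delta s *:
    ((l2 s * cosh (Theta s) - l3 s * sinh (Theta s)) *: bnu1 s
     - (- l2 s * sinh (Theta s) + l3 s * cosh (Theta s)) *: bnu2 s).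
  move=> Is; have [_ -> _ _] := frenet s Is.
  rewrite (comb_rotate _ _ _ _ (cs s)) -/delta.
  by apply/rowP => i; rewrite !mxE; ring.
split.
- split; first exact: smg.
  + apply/smooth_onP => n; apply: (ndiff_onD openI).
      exact: ndiff_on_scale openI (chI n) (sm1 n).
    exact: ndiff_onN openI (ndiff_on_scale openI (shI n) (sm2 n)).
  + apply/smooth_onP => n; apply: (ndiff_onD openI).
      exact: ndiff_on_scale openI (ndiff_onN openI (shI n)) (sm1 n).
    exact: ndiff_on_scale openI (chI n) (sm2 n).
  + move=> s Is; have [Ds g1 g2] := frame s Is; split.
    * exact: Delta1_rotate hD (cs s) Ds.
    * by rewrite /bnu1 -scaleNr linner_comb_r g1 g2 !mulr0 addr0.
    * by rewrite /bnu2 linner_comb_r g1 g2 !mulr0 addr0.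
- by move=> s Is; exact: lcross_rotate (cs s).
- move=> dTheta bl2 bl3 s Is; have [[_ d1] [_ d2]] := derivative s Is.
  have turn0 : - derive1 Theta s + l1 s = 0 by rewrite (dTheta s Is) addNr.
  rewrite !derive1E d1 d2 turn0 !scale0r !addr0.
  split; [|by []|by []].
  rewrite -derive1E (dmu s Is) scalerBr !scalerA.
  by rewrite -/(bl2 s) -/(bl3 s) [- delta s * bl3 s]mulNr scaleNr opprK.
- move=> p l2p l3p _ q s Is; have [[_ d1] [_ d2]] := derivative s Is.
  have bl2E : l2 s * cosh (Theta s) - l3 s * sinh (Theta s) = p s.
    by rewrite (l2p s Is) (l3p s Is) -[RHS]mulr1 -(cs s); ring.
  have bl3E : - l2 s * sinh (Theta s) + l3 s * cosh (Theta s) = 0.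
    by rewrite (l2p s Is) (l3p s Is); ring.
  rewrite (dmu s Is) !derive1E d1 d2 bl2E bl3E !scale0r add0r subr0.
  by rewrite scalerA.
Qed.
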